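(* Assume the standing setting and Assumptions (A1), (A2), (A3) described in the context, and let $\xi\in L^2_{\mathcal{F}_{N-1}}(\Omega;\mathbb{R}^n)$. A control $u^*=\{u_k^*\}_{k\in\mathcal{T}}\in\mathcal{U}$ is optimal for the terminal state $\xi$ (i.e. $\mathcal{J}(N,\xi;u^* )=\inf_{u\in\mathcal{U}}\mathcal{J}(N,\xi;u)$) if and only if there exists a pair of square-integrable processes $(x^*,y^* )=(x_k^*,y_k^* )_{k=0}^N$ satisfying the Hamiltonian system $x_{k+1}^*=A_k^\top x_k^*+Q_k\mathbb{E}_{k-1}[y_{k+1}^*]+S_k^\top u_k^*+\eta_k+C_k^\top x_k^*\omega_k$, $y_k^*=A_k\mathbb{E}_{k-1}[y_{k+1}^*]+B_ku_k^*+C_k\mathbb{E}_{k-1}[y_{k+1}^*\omega_k]+q_k$, for $k\in\mathcal{T}$, $x_0^*=G_0y_0^*$, $y_N^*=\xi$, together with the stationarity condition $B_k^\top x_k^*+S_k\mathbb{E}_{k-1}[y_{k+1}^*]+R_ku_k^*+\rho_k=0$ for all $k\in\mathcal{T}$.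
   Context: Fix integers $N\ge 1$, $n,m\ge1$, $\mathcal{T}=\{0,\dots,N-1\}$. $(\Omega,\mathcal{F},\mathbb{P})$ complete with scalar sequence $\{\omega_k\}_{k\in\mathcal{T}}$, $\mathcal{F}_k=\sigma\{\omega_0,\dots,\omega_k\}$ (completed), $\mathcal{F}_{-1}$ trivial, $\mathbb{E}[\omega_k\mid\mathcal{F}_{k-1}]=0$, $\mathbb{E}[\omega_k^2\mid\mathcal{F}_{k-1}]=1$. $\mathbb{E}_{k-1}[\cdot]=\mathbb{E}[\cdot\mid\mathcal{F}_{k-1}]$. $L^2_{\mathcal{F}_{N-1}}(\Omega;\mathbb{R}^n)$ = square-integrable $\mathcal{F}_{N-1}$-measurable vectors; $L^2_{\mathbb{F}}(\mathcal{T};\mathbb{R}^d)$ = processes $(h_k)_{k\in\mathcal{T}}$, $h_k$ $\mathcal{F}_{k-1}$-measurable, $\mathbb{E}\sum|h_k|^2<\infty$. $\mathcal{U}=L^2_{\mathbb{F}}(\mathcal{T};\mathbb{R}^m)$. (A1): $A_k,C_k\in\mathbb{R}^{n\times n}$, $B_k\in\mathbb{R}^{n\times m}$ deterministic; $q\in L^2_{\mathbb{F}}(\mathcal{T};\mathbb{R}^n)$. (A2): $G_0\in\mathbb{S}^n$, $Q_k\in\mathbb{S}^n$, $R_k\in\mathbb{S}^m$, $S_k\in\mathbb{R}^{m\times n}$ deterministic; $\eta\in L^2_{\mathbb{F}}(\mathcal{T};\mathbb{R}^n)$, $\rho\in L^2_{\mathbb{F}}(\mathcal{T};\mathbb{R}^m)$.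 (A3): $G_0\ge0$, $R_k$ uniformly positive definite ($R_k\ge\delta I$ for some $\delta>0$), and $Q_k-S_k^\top R_k^{-1}S_k\ge0$ for all $k\in\mathcal{T}$. State equation: $y_k=A_k\mathbb{E}_{k-1}[y_{k+1}]+B_ku_k+C_k\mathbb{E}_{k-1}[y_{k+1}\omega_k]+q_k$ ($k\in\mathcal{T}$), $y_N=\xi$, with unique adapted square-integrable solution $y^{(\xi,u)}$. Cost: $\mathcal{J}(N,\xi;u)=\frac12\mathbb{E}\{\langle G_0y_0,y_0\rangle+\sum_{k=0}^{N-1}[\langle Q_k\bar y_k,\bar y_k\rangle+2\langle S_k\bar y_k,u_k\rangle+\langle R_ku_k,u_k\rangle+2\langle\eta_k,\bar y_k\rangle+2\langle\rho_k,u_k\rangle]\}$, $\bar y_k=\mathbb{E}_{k-1}[y_{k+1}]$, $y=y^{(\xi,u)}$. *)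

(* Defs.v *)
From HB Require Import structures.
From mathcomp Require Import all_boot all_order all_algebra.
From mathcomp Require Import all_classical all_reals all_analysis.
Set Implicit Arguments. Unset Strict Implicit. Unset Printing Implicit Defensive.
Import Order.TTheory GRing.Theory Num.Theory.
Local Open Scope classical_set_scope.
Local Open Scope ring_scope.

Section SettingDefs.
Context {R : realType} {d : measure_display} {Omega : measurableType d}
  (P : probability Omega R).

Definition rmeas (G : set (set Omega)) (f : Omega -> R) : Prop :=
  forall B : set R, measurable B -> G (f @^-1` B).

Definition vmeas (G : set (set Omega)) {p : nat} (X : Omega -> 'cV[R]_p) : Prop :=
  forall i : 'I_p, rmeas G (fun w => X w i 0).

Definition L2v {p : nat} (X : Omega -> 'cV[R]_p) : Prop :=
  vmeas measurable X /\
  forall i : 'I_p, P.-integrable setT (fun w => ((X w i 0) ^+ 2)%:E).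

Definition cexp (G : set (set Omega)) (X Z : Omega -> R) : Prop :=
  rmeas G Z /\ P.-integrable setT (fun w => (Z w)%:E) /\
  P.-integrable setT (fun w => (X w)%:E) /\
  forall A, G A -> (\int[P]_(w in A) (Z w)%:E = \int[P]_(w in A) (X w)%:E)%E.

Definition cexpv (G : set (set Omega)) {p : nat} (X Z : Omega -> 'cV[R]_p) : Prop :=
  forall i : 'I_p, cexp G (fun w => X w i 0) (fun w => Z w i 0).

Definition completion (G : set (set Omega)) : set (set Omega) :=
  [set A | exists B M, G B /\ measurable M /\ P M = 0%E /\
           (A `\` B) `|` (B `\` A) `<=` M].

(* Fm om k = F_{k-1} = completed sigma(om_0, ..., om_{k-1});
   Fm om 0 = F_{-1} = (completed) trivial sigma-algebra. *)
Definition Fm (om : nat -> Omega -> R) (k : nat) : set (set Omega) :=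
  completion <<s [set A | exists j, (j < k)%N /\
                  exists B : set R, measurable B /\ A = om j @^-1` B] >>.

Section Problem.
Variables (om : nat -> Omega -> R) (N n m : nat).
Variables (A C : nat -> 'M[R]_n) (B : nat -> 'M[R]_(n, m))
  (q : nat -> Omega -> 'cV[R]_n).
Variables (G0 : 'M[R]_n) (Q : nat -> 'M[R]_n) (Rm : nat -> 'M[R]_m)
  (S : nat -> 'M[R]_(m, n)) (eta : nat -> Omega -> 'cV[R]_n)
  (rho : nat -> Omega -> 'cV[R]_m).

Definition admissible (u : nat -> Omega -> 'cV[R]_m) : Prop :=
  forall k, (k < N)%N -> vmeas (Fm om k) (u k) /\ L2v (u k).

Definition is_state (xi : Omega -> 'cV[R]_n) (u : nat -> Omega -> 'cV[R]_m)
  (y ybar : nat -> Omega -> 'cV[R]_n) : Prop :=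
  (forall k, (k <= N)%N -> vmeas (Fm om k) (y k) /\ L2v (y k)) /\
  {ae P, forall w, y N w = xi w} /\
  forall k, (k < N)%N ->
    cexpv (Fm om k) (y k.+1) (ybar k) /\
    exists yw : Omega -> 'cV[R]_n,
      cexpv (Fm om k) (fun w => om k w *: y k.+1 w) yw /\
      {ae P, forall w, y k w =
         A k *m ybar k w + B k *m u k w + C k *m yw w + q k w}.

Definition cost_integrand (u : nat -> Omega -> 'cV[R]_m)
  (y ybar : nat -> Omega -> 'cV[R]_n) (w : Omega) : R :=
  ((y 0 w)^T *m G0 *m y 0 w) 0 0 +
  \sum_(k < N)
    ( ((ybar k w)^T *m Q k *m ybar k w) 0 0
    + 2 * ((u k w)^T *m (S k *m ybar k w)) 0 0
    + ((u k w)^T *m Rm k *m u k w) 0 0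
    + 2 * ((eta k w)^T *m ybar k w) 0 0
    + 2 * ((rho k w)^T *m u k w) 0 0 ).

Definition cost_is (xi : Omega -> 'cV[R]_n) (u : nat -> Omega -> 'cV[R]_m)
  (c : R) : Prop :=
  exists y ybar, is_state xi u y ybar /\
    (c%:E = (2^-1)%:E * \int[P]_w (cost_integrand u y ybar w)%:E)%E.

Definition optimal (xi : Omega -> 'cV[R]_n) (us : nat -> Omega -> 'cV[R]_m)
  : Prop :=
  admissible us /\
  exists cs, cost_is xi us cs /\
    forall u c, admissible u -> cost_is xi u c -> cs <= c.

Definition hamiltonian (xi : Omega -> 'cV[R]_n) (us : nat -> Omega -> 'cV[R]_m)
  (x y : nat -> Omega -> 'cV[R]_n) : Prop :=
  (forall k, (k <= N)%N ->
     vmeas (Fm om k) (x k) /\ L2v (x k) /\ vmeas (Fm om k) (y k) /\ L2v (y k)) /\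
  {ae P, forall w, x 0 w = G0 *m y 0 w} /\
  {ae P, forall w, y N w = xi w} /\
  forall k, (k < N)%N ->
    exists ybar yw : Omega -> 'cV[R]_n,
      cexpv (Fm om k) (y k.+1) ybar /\
      cexpv (Fm om k) (fun w => om k w *: y k.+1 w) yw /\
      {ae P, forall w, x k.+1 w =
         (A k)^T *m x k w + Q k *m ybar w + (S k)^T *m us k w + eta k w
         + om k w *: ((C k)^T *m x k w)} /\
      {ae P, forall w, y k w =
         A k *m ybar w + B k *m us k w + C k *m yw w + q k w} /\
      {ae P, forall w,
         (B k)^T *m x k w + S k *m ybar w + Rm k *m us k w + rho k w = 0}.

End Problem.
End SettingDefs.

(* Main.v *)
(* Since the state equation is affine, replacing [u] by [u + a v] changes the
   state by [a z], with [z] the solution of the homogeneous equation driven by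
   [v] with zero terminal value, and the cost becomes a quadratic polynomial in
   [a].  Pairing [z] with the forward process [x] telescopes over time and shows
   that the linear coefficient is [\sum_k E<D_k, v_k>], where [D_k] is the
   left-hand side of the stationarity condition.  The quadratic coefficient is
   nonnegative by (A3), after completing the square.  Hence [D = 0] is
   sufficient, and taking [v = - D] shows that it is necessary.  The existence
   of [z] rests on conditional expectations, obtained as Radon-Nikodym
   derivatives on the sub-sigma-algebra. *)
Require Import Defs.
From HB Require Import structures.
From mathcomp Require Import all_boot all_order all_algebra.
From mathcomp Require Import all_classical all_reals all_analysis.
From mathcomp Require Import finmap measurable_realfun zify ring lra.
Import Order.TTheory GRing.Theory Num.Theory.
Import HBSimple HBNNSimple.
Local Open Scope classical_set_scope.
Local Open Scope ring_scope.
Set Implicit Arguments. Unset Strict Implicit. Unset Printing Implicit Defensive.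

(** * Square-integrable functions *)

(** The delicate point is integrability. [om k] is not assumed bounded or independent of the past,
    so [om k *: x k] and the conditional expectation of [om k *: y k.+1] come from products of
    square-integrable functions, which are a priori only integrable. The unit conditional variance
    repairs this: multiplication by [om k] is an isometry on square-integrable
    [Fm P om k]-measurable functions, and its adjoint, the conditional expectation of [om k * y], is
    a contraction. Both facts are proved on truncations and passed to the limit. The constant 1 also
    has unit conditional variance, so the two conditional expectations of the state equation share
    the same lemmas. Since conditional expectation is a relation, fixed only up to null sets, the
    cost identities are stated for an arbitrary choice of state and [ybar]. *)

Section RealIntegrals.
Context {R : realType} {d : measure_display} {T : measurableType d}
  (P : {measure set T -> \bar R}).
Implicit Types f g : T -> R.

Definition intg f := P.-integrable setT (EFin \o f).

Definition sqintg f := measurable_fun setT f /\ intg (fun w => f w ^+ 2).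

Lemma intgD f g : intg f -> intg g -> intg (fun w => f w + g w).
Proof. by move=> fi gi; exact: (integrableD measurableT fi gi). Qed.

Lemma intgZ (a : R) f : intg f -> intg (fun w => a * f w).
Proof. by move=> fi; exact: (integrableZl measurableT a fi). Qed.

Lemma intg_meas f : intg f -> measurable_fun setT f.
Proof. by move=> /measurable_int /measurable_EFinP. Qed.

Lemma intg_le f g : measurable_fun setT f -> (forall w, `|f w| <= g w) ->
  intg g -> intg f.
Proof.
move=> mf fg; apply: le_integrable => //; first exact/measurable_EFinP.
by move=> w _ /=; rewrite lee_fin (le_trans (fg w))// ler_norm.
Qed.

Lemma intg_sum (I : eqType) (s : seq I) (F : I -> T -> R) :
  (forall i, i \in s -> intg (F i)) -> intg (fun w => \sum_(i <- s) F i w).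
Proof.
elim: s => [|i s IH] Fi.
  by under eq_fun do rewrite big_nil; exact: integrable0.
under eq_fun do rewrite big_cons.
apply: intgD; first by apply: Fi; rewrite mem_head.
by apply: IH => j js; apply: Fi; rewrite in_cons js orbT.
Qed.

Lemma Rintegral_sum (I : eqType) (s : seq I) (F : I -> T -> R) :
  (forall i, i \in s -> intg (F i)) ->
  \int[P]_w (\sum_(i <- s) F i w) = \sum_(i <- s) \int[P]_w (F i w).
Proof.
elim: s => [|i s IH] Fi.
  under eq_Rintegral do rewrite big_nil.
  by rewrite big_nil /Rintegral integral0.
under eq_Rintegral do rewrite big_cons.
have Fs j : j \in s -> intg (F j) by move=> js; apply: Fi; rewrite in_cons js orbT.
rewrite big_cons RintegralD ?IH//; first by apply: Fi; rewrite mem_head.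
exact: intg_sum.
Qed.

Lemma sqintgM f g : sqintg f -> sqintg g -> intg (fun w => f w * g w).
Proof.
move=> [mf fi] [mg gi]; apply: (intg_le _ _ (intgD fi gi)).
  exact: measurable_funM.
by move=> w; rewrite ler_norml; apply/andP; split; nra.
Qed.

Lemma sqintgD f g : sqintg f -> sqintg g -> sqintg (fun w => f w + g w).
Proof.
move=> sf sg; have [mf fi] := sf; have [mg gi] := sg; split.
  exact: measurable_funD.
rewrite [X in intg X](_ : _ = fun w => (f w ^+ 2 + g w ^+ 2) + 2 * (f w * g w)).
  by apply: intgD; [exact: intgD|apply: intgZ; exact: sqintgM].
by apply/funext => w; ring.
Qed.

Lemma sqintgZ (a : R) f : sqintg f -> sqintg (fun w => a * f w).
Proof.
move=> [mf fi]; split; first exact: measurable_funM.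
rewrite [X in intg X](_ : _ = fun w => a ^+ 2 * (f w ^+ 2)); first exact: intgZ.
by apply/funext => w; ring.
Qed.

Lemma sqintg0 : sqintg (fun=> 0).
Proof. by split => //; under eq_fun do rewrite expr0n; exact: integrable0. Qed.

Lemma sqintg_sum (I : eqType) (s : seq I) (F : I -> T -> R) :
  (forall i, i \in s -> sqintg (F i)) -> sqintg (fun w => \sum_(i <- s) F i w).
Proof.
elim: s => [|i s IH] Fi; first by under eq_fun do rewrite big_nil; exact: sqintg0.
under eq_fun do rewrite big_cons.
apply: sqintgD; first by apply: Fi; rewrite mem_head.
by apply: IH => j js; apply: Fi; rewrite in_cons js orbT.
Qed.

(** Large values are cut to 0 rather than clamped to [M]: then [trunc M f * f = trunc M f ^+ 2], an
    identity on which the contraction estimate for conditional expectations rests. *)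
Definition trunc (M : R) f w := if `|f w| <= M then f w else 0.

Lemma trunc_bounded M f w : 0 <= M -> `|trunc M f w| <= M.
Proof. by move=> M0; rewrite /trunc; case: ifP => //; rewrite normr0. Qed.

Lemma intg_bounded_mul (M : R) f g : measurable_fun setT f ->
  (forall w, `|f w| <= M) -> intg g -> intg (fun w => f w * g w).
Proof.
move=> mf fM gi; apply: (intg_le (g := fun w => M * `|g w|)).
- by apply: measurable_funM => //; exact: intg_meas gi.
- by move=> w; rewrite normrM ler_wpM2r.
- by apply: intgZ; exact: (integrable_norm gi).
Qed.

Lemma measurable_trunc (M : R) f :
  measurable_fun setT f -> measurable_fun setT (trunc M f).
Proof.
move=> mf; apply: measurable_fun_ifT => //; apply: measurable_fun_ler => //.
exact: measurableT_comp.
Qed.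

(** Monotone convergence: the squares increase with the truncation level, so a bound uniform in the
    level survives in the limit. The weight [a] is the noise in one application and 1 in the
    other. *)
Lemma intg_sq_mul_trunc (a f : T -> R) (K : R) :
  measurable_fun setT a -> measurable_fun setT f ->
  (forall k : nat, (\int[P]_w ((a w * trunc k%:R f w) ^+ 2)%:E <= K%:E)%E) ->
  intg (fun w => (a w * f w) ^+ 2).
Proof.
move=> ma mf fK.
have m2 k : measurable_fun setT (fun w => ((a w * trunc k%:R f w) ^+ 2)%:E).
  apply/measurable_EFinP; apply: measurable_funX; apply: measurable_funM => //.
  exact: measurable_trunc.
have nd w (k l : nat) : (k <= l)%N ->
    (a w * trunc k%:R f w) ^+ 2 <= (a w * trunc l%:R f w) ^+ 2.
  move=> kl; rewrite !exprMn ler_wpM2l ?sqr_ge0// /trunc.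
  have kl' : (k%:R : R) <= l%:R by rewrite ler_nat.
  case: ifPn => [fk|_]; first by rewrite (le_trans fk kl').
  by rewrite expr0n sqr_ge0.
apply/integrableP; split.
  by apply/measurable_EFinP; apply: measurable_funX; exact: measurable_funM.
rewrite (eq_integral (fun w => ((a w * f w) ^+ 2)%:E)); last first.
  by move=> w _; rewrite /= ger0_norm// sqr_ge0.
apply: (@le_lt_trans _ _ K%:E); last exact: ltry.
rewrite (_ : (\int[P]_w _)%E =
  \int[P]_w (limn (fun k : nat => ((a w * trunc k%:R f w) ^+ 2)%:E)))%E; last first.
  apply: eq_integral => w _; apply/esym/cvg_lim => //.
  (* Once [k] exceeds [|f w|] the truncation leaves [f w] unchanged, so the sequence is eventually
     constant at each point. *)
  apply: cvg_near_cst; near=> k.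
  rewrite /trunc ifT//; near: k; exact: nbhs_infty_ger.
rewrite monotone_convergence//.
- apply: lime_le; last by near=> k; exact: fK.
  apply: ereal_nondecreasing_is_cvgn => k l kl; apply: ge0_le_integral => //=.
  + by move=> w _; rewrite lee_fin sqr_ge0.
  + by move=> w _; rewrite lee_fin nd.
- by move=> k w _; rewrite lee_fin sqr_ge0.
- by move=> w _ k l kl; rewrite lee_fin nd.
Unshelve. all: by end_near. Qed.

End RealIntegrals.

(** * Conditional expectation *)

Section SubSigmaAlgebra.
Context {R : realType} {d : measure_display} {T : measurableType d}
  (P : probability T R) (G : set (set T)).
Hypotheses (sG : sigma_algebra setT G) (GM : G `<=` measurable).
Implicit Types (f g h X Z : T -> R).

(** Gives access to the library closure properties of measurable functions: [G] is already a
    sigma-algebra, so the one generated by it on [g_sigma_algebraType G] is [G] itself. *)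
Lemma rmeasP f :
  rmeas G f <-> measurable_fun setT (f : g_sigma_algebraType G -> R).
Proof.
split=> [mf _ B mB|mf B mB]; first by rewrite setTI; apply: sub_sigma_algebra; exact: mf.
rewrite -(sigma_algebra_id sG) -[X in smallest _ _ X]setTI.
exact: (mf measurableT B mB).
Qed.

Lemma rmeas_measurable f : rmeas G f -> measurable_fun setT f.
Proof. by move=> mf _ B mB; rewrite setTI; apply: GM; exact: mf. Qed.

Lemma rmeasD f g : rmeas G f -> rmeas G g -> rmeas G (fun w => f w + g w).
Proof. by move=> /rmeasP mf /rmeasP mg; apply/rmeasP; exact: measurable_funD. Qed.

Lemma rmeasM f g : rmeas G f -> rmeas G g -> rmeas G (fun w => f w * g w).
Proof. by move=> /rmeasP mf /rmeasP mg; apply/rmeasP; exact: measurable_funM. Qed.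

Lemma rmeas_cst (a : R) : rmeas G (fun=> a).
Proof. by apply/rmeasP. Qed.

Lemma rmeas_trunc (M : R) f : rmeas G f -> rmeas G (trunc M f).
Proof.
move=> /rmeasP mf; apply/rmeasP.
apply: measurable_fun_ifT => //; apply: measurable_fun_ler => //.
exact: measurableT_comp.
Qed.

Lemma rmeas_sum (I : Type) (s : seq I) (F : I -> T -> R) :
  (forall i, rmeas G (F i)) -> rmeas G (fun w => \sum_(i <- s) F i w).
Proof.
move=> Fi; elim: s => [|i s IH].
  by under eq_fun do rewrite big_nil; exact: rmeas_cst.
by under eq_fun do rewrite big_cons; exact: rmeasD.
Qed.

Lemma intg_indicM f (A : set T) : intg P f -> measurable A ->
  intg P (fun w => \1_A w * f w).
Proof.
move=> fi mA.
apply: (intg_le (g := fun w => `|f w|)).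
- by apply: measurable_funM => //; exact: (intg_meas fi).
- move=> w; rewrite normrM ler_piMl// indicE.
  by case: (_ \in _); rewrite ?normr1 ?normr0.
- exact: integrable_norm fi.
Qed.

Lemma Rintegral_indic (f : T -> R) (A : set T) :
  \int[P]_w (\1_A w * f w) = \int[P]_(w in A) f w.
Proof.
rewrite [RHS]Rintegral_mkcond; apply: eq_Rintegral => w _.
by rewrite patchE indicE; case: ifP => _; rewrite ?mul1r ?mul0r.
Qed.

(* Approximating [h >= 0] by [G]-simple functions, both products are dominated
   by [h * X] and [h * Z], so no boundedness of [h] is required. *)
Lemma cexp_pullout_ge0 X Z h : cexp P G X Z -> rmeas G h ->
  (forall w, 0 <= h w) ->
  intg P (fun w => h w * X w) -> intg P (fun w => h w * Z w) ->
  \int[P]_w (h w * X w) = \int[P]_w (h w * Z w).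
Proof.
move=> [mZ [iZ [iX XZ]]] mh h0 ihX ihZ.
pose T' := g_sigma_algebraType G.
have mh' : measurable_fun (setT : set T') (EFin \o (h : T' -> R)).
  by apply/measurable_EFinP; exact/rmeasP.
pose g := nnsfun_approx measurableT mh'.
have Gpre n (y : R) : G (g n @^-1` [set y]).
  by apply/(rmeasP (g n)).2 => //; exact: measurable_funP.
have gh w n : g n w <= h w.
  by rewrite -lee_fin /g nnsfun_approxE; apply: le_approx => // x _; rewrite lee_fin.
have gcvg w : EFin \o g ^~ w @ \oo --> (h w)%:E.
  by apply: cvg_nnsfun_approx => // x _; rewrite lee_fin.
(* Splitting the simple function along its level sets, which lie in [G], reduces the identity to the
   defining property of [cexp]. *)
have gE n Y : intg P Y ->
    intg P (fun w => g n w * Y w) /\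
    \int[P]_w (g n w * Y w) =
     \sum_(y <- fset_set (range (g n))) y * \int[P]_(w in g n @^-1` [set y]) Y w.
  move=> iY.
  have EY : (fun w => g n w * Y w) = fun w => \sum_(y <- fset_set (range (g n)))
      y * (\1_(g n @^-1` [set y]) w * Y w).
    apply/funext => w; rewrite fimfunE fsbig_finite//= mulr_suml.
    by apply: eq_bigr => y _; rewrite mulrA.
  rewrite EY; split.
    by apply: intg_sum => y _; apply: intgZ; apply: intg_indicM => //; exact: GM.
  rewrite Rintegral_sum; last first.
    by move=> y _; apply: intgZ; apply: intg_indicM => //; exact: GM.
  apply: eq_bigr => y _; rewrite RintegralZl//; first by rewrite Rintegral_indic.
  by apply: intg_indicM => //; exact: GM.
have gXZ n : \int[P]_w (g n w * X w) = \int[P]_w (g n w * Z w).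
  rewrite (gE n X iX).2 (gE n Z iZ).2; apply: eq_bigr => y _; congr (_ * _).
  by rewrite /Rintegral XZ.
have lim Y : intg P Y -> intg P (fun w => h w * Y w) ->
    ((fun n => (\int[P]_w (g n w * Y w)%:E)%E) @ \oo -->
      (\int[P]_w (h w * Y w)%:E)%E).
  move=> iY ihY.
  have [] // := @dominated_convergence _ _ _ P setT measurableT
    (fun n w => (g n w * Y w)%:E) (fun w => (h w * Y w)%:E)
    (fun w => `|h w * Y w|%:E).
  - by move=> n; apply/measurable_EFinP; exact: (intg_meas (gE n Y iY).1).
  - by apply/measurable_EFinP; exact: (intg_meas ihY).
  - apply: aeW => w _.
    under eq_fun do rewrite EFinM.
    by rewrite EFinM; apply: cvgeZr => //; exact: gcvg.
  - exact: (integrable_norm ihY).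
  - apply: aeW => w n _; rewrite abse_EFin lee_fin !normrM ler_wpM2r//.
    by rewrite !ger0_norm//; exact: gh.
have := lim Z iZ ihZ; have := lim X iX ihX.
have -> : (fun n => (\int[P]_w (g n w * X w)%:E)%E) =
          (fun n => (\int[P]_w (g n w * Z w)%:E)%E).
  apply/funext => n.
  have fin Y : intg P Y -> (\int[P]_w (g n w * Y w)%:E)%E \is a fin_num.
    by move=> iY; apply: integrable_fin_num => //; exact: (gE n Y iY).1.
  by rewrite -(fineK (fin X iX)) -(fineK (fin Z iZ)); congr EFin; exact: gXZ.
move=> /cvg_lim c1 /cvg_lim c2.
by rewrite /Rintegral -c1// c2.
Qed.

(** Split [h] into positive and negative parts; each is dominated by [|h|], so the products with [X]
    and [Z] stay integrable. *)
Lemma cexp_pullout X Z h : cexp P G X Z -> rmeas G h ->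
  intg P (fun w => h w * X w) -> intg P (fun w => h w * Z w) ->
  \int[P]_w (h w * X w) = \int[P]_w (h w * Z w).
Proof.
move=> XZ mh ihX ihZ.
have mp : rmeas G (fun w => Num.max (h w) 0).
  by apply/rmeasP; apply: measurable_maxr => //; exact/rmeasP.
have mn : rmeas G (fun w => Num.max (- h w) 0).
  by apply/rmeasP; apply: measurable_maxr => //;
    apply: measurableT_comp => //; exact/rmeasP.
have hE w : h w = Num.max (h w) 0 - Num.max (- h w) 0.
  by rewrite /Num.max; case: ifPn; case: ifPn; lra.
have bound Y (e : T -> R) : measurable_fun setT Y -> rmeas G e ->
    intg P (fun w => h w * Y w) -> (forall w, `|e w| <= `|h w|) ->
    intg P (fun w => e w * Y w).
  move=> mY me ihY eh; apply: (intg_le (g := fun w => `|h w * Y w|)).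
  - by apply: measurable_funM => //; exact: rmeas_measurable.
  - by move=> w; rewrite !normrM ler_wpM2r.
  - exact: (integrable_norm ihY).
have [mZ [iZ [iX _]]] := XZ.
have mX := intg_meas iX; have mZ' := intg_meas iZ.
have bp w : `|Num.max (h w) 0| <= `|h w|.
  by rewrite /Num.max; case: ifPn => //; rewrite normr0.
have bn w : `|Num.max (- h w) 0| <= `|h w|.
  by rewrite /Num.max; case: ifPn => //; rewrite ?normr0 ?normrN.
have split Y : measurable_fun setT Y -> intg P (fun w => h w * Y w) ->
    \int[P]_w (h w * Y w) = \int[P]_w (Num.max (h w) 0 * Y w) -
      \int[P]_w (Num.max (- h w) 0 * Y w).
  move=> mY ihY; rewrite -RintegralB//; [|exact: bound|exact: bound].
  by apply: eq_Rintegral => w _; rewrite -mulrBl -hE.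
rewrite (split X)// (split Z)//; congr (_ - _); apply: cexp_pullout_ge0 => //.
- by move=> w; rewrite le_max lexx orbT.
- exact: bound.
- exact: bound.
- by move=> w; rewrite le_max lexx orbT.
- exact: bound.
- exact: bound.
Qed.

End SubSigmaAlgebra.

Section ConditionalExpectation.
Context {R : realType} {d : measure_display} {T : measurableType d}
  (P : probability T R) (G : set (set T)).
Hypotheses (sG : sigma_algebra setT G) (GM : G `<=` measurable).
Implicit Types (f g h X Z : T -> R).

(** [P] and the charge with density [X] are pushed forward along the identity to [T'], which is [T]
    with the coarser sigma-algebra [G]. The Radon-Nikodym density taken there is [G]-measurable by
    construction; its values are finite, so [fine] loses nothing. *)
Lemma cexp_exists X : intg P X -> exists Z, cexp P G X Z.
Proof.
move=> iX.
pose T' := g_sigma_algebraType G.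
have mid : measurable_fun setT (idfun : T -> T').
  by move=> _ B; rewrite /measurable/= sigma_algebra_id// => GB; rewrite setTI; exact: GM.
pose idm : {mfun T >-> T'} := mfun_Sub (mem_set mid).
have idmE w : idm w = w by rewrite /idm mfun_valP.
pose mu := distribution P idm.
pose nu : {charge set T' -> \bar R} :=
  measure_function_pushforward__canonical__charge_Charge (induced_charge iX) mid.
have mT A : measurable (A : set T') -> d.-measurable A.
  by move=> mA; rewrite -[X in measurable X]setTI; exact: (mid measurableT A mA).
have numu : nu `<< mu.
  apply/null_content_dominatesP => A mA PA0.
  apply: null_set_integral; [exact: mT| |exact: PA0].
  by apply: measurable_funTS; exact: measurable_int iX.
pose f := Radon_Nikodym nu mu.
have ffin w : f w \is a fin_num by exact: Radon_Nikodym_fin_num.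
have fi : mu.-integrable setT f by exact: Radon_Nikodym_integrable.
have mf := measurable_int _ fi.
have Ef : (fun w : T => (fine (f w))%:E) = f \o idm.
  by apply/funext => w; rewrite fineK//= idmE.
have fiP : P.-integrable setT (f \o idm).
  apply/integrableP; split; first exact: measurableT_comp.
  have /integrableP[_] := fi.
  have mf2 : measurable_fun setT (abse \o f) by exact: measurableT_comp.
  by rewrite (ge0_integral_distribution idm mf2)// => y; exact: abse_ge0.
exists (fun w => fine (f w)); split; [|split; [|split]].
- apply/(rmeasP sG); apply: measurableT_comp => //; exact: fine_measurable.
- by rewrite Ef.
- exact: iX.
- move=> A GA.
  have mA : measurable (A : set T') by apply: sub_sigma_algebra.
  rewrite Ef.
  have := Radon_Nikodym_integral numu mA.
  rewrite /= {1}/pushforward preimage_id /induced_charge => ->.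
  rewrite (@integral_pushforward _ _ _ _ _ idm _ P A f)//.
  by apply: (integrableS measurableT) => //; rewrite -[X in measurable X]setTI;
    exact: (measurable_funP idm).
Qed.


(** The condition E[e^2 | G] = 1, tested on the sets of [G]. It is instantiated with [e = om k] and
    with [e = 1]. *)
Definition unit_variance (e : T -> R) :=
  sqintg P e /\ forall E, G E -> (\int[P]_(w in E) (e w ^+ 2)%:E = P E)%E.

Lemma unit_variance1 : unit_variance (fun=> 1).
Proof.
split; first by split => //; exact: finite_measure_integrable_cst.
move=> E GE; under eq_integral do rewrite expr1n.
by rewrite integral_cst ?mul1e//; exact: GM.
Qed.

Lemma unit_variance_cexp e : unit_variance e ->
  cexp P G (fun w => e w ^+ 2) (fun=> 1).
Proof.
move=> [[me ie] eE]; split; [exact: rmeas_cst|split; [|split => //]].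
  exact: finite_measure_integrable_cst.
by move=> A GA; rewrite eE// integral_cst ?mul1e//; exact: GM.
Qed.

(** The truncation is bounded and [G]-measurable, so its square can be pulled out of the conditional
    expectation of [e ^+ 2], which is 1. *)
Lemma trunc_noise (k : nat) e h : unit_variance e -> rmeas G h ->
  sqintg P (fun w => e w * trunc k%:R h w) /\
  \int[P]_w ((e w * trunc k%:R h w) ^+ 2) = \int[P]_w (trunc k%:R h w ^+ 2).
Proof.
move=> ue mh; have [[me ie] _] := ue.
have mb := rmeas_trunc sG k%:R mh.
have mb2 : rmeas G (fun w => trunc k%:R h w ^+ 2) by exact: rmeasM.
have b2 w : `|trunc k%:R h w ^+ 2| <= k%:R ^+ 2.
  by rewrite normrX ler_pXn2r ?nnegrE// trunc_bounded.
have i1 : intg P (fun w => trunc k%:R h w ^+ 2 * e w ^+ 2).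
  exact: intg_bounded_mul (rmeas_measurable GM mb2) b2 ie.
have EE : (fun w => (e w * trunc k%:R h w) ^+ 2) =
    fun w => trunc k%:R h w ^+ 2 * e w ^+ 2.
  by apply/funext => w; rewrite exprMn mulrC.
split.
  split; last by rewrite EE.
  by apply: measurable_funM => //; exact: rmeas_measurable mb.
rewrite EE (cexp_pullout sG GM (unit_variance_cexp ue))//.
  by apply: eq_Rintegral => w _; rewrite mulr1.
apply: (intg_bounded_mul (rmeas_measurable GM mb2) b2).
exact: finite_measure_integrable_cst.
Qed.

Lemma intg_trunc_sq (k : nat) h : rmeas G h -> intg P (fun w => trunc k%:R h w ^+ 2).
Proof.
move=> mh; have [[_ +] _] := trunc_noise k unit_variance1 mh.
by under eq_fun do rewrite mul1r.
Qed.

(** By the isometry on truncations, the second moments of [e * trunc k h] are bounded by that of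
    [h], uniformly in [k]. *)
Lemma sqintg_noise e h : unit_variance e -> rmeas G h -> sqintg P h ->
  sqintg P (fun w => e w * h w).
Proof.
move=> ue mh [mh' ih]; have [[me ie] _] := ue.
split; first exact: measurable_funM.
apply: (@intg_sq_mul_trunc _ _ _ _ _ _ (\int[P]_w (h w ^+ 2))) => // k.
have [[_ ib] eb] := trunc_noise k ue mh.
rewrite -[leLHS]fineK ?lee_fin; last exact: integrable_fin_num.
rewrite -/(Rintegral _ _ _) eb.
apply: le_Rintegral => //; first exact: intg_trunc_sq.
by move=> w _; rewrite /trunc; case: ifP => // _; rewrite expr0n sqr_ge0.
Qed.

(* For [b] a truncation of [Z] at level [k],
   [E b^2 = E (b e y) <= (E y^2 + E (e b)^2) / 2] and [E (e b)^2 = E b^2]. *)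
Lemma cexp_sqintg e y Z : unit_variance e -> sqintg P y ->
  cexp P G (fun w => e w * y w) Z -> sqintg P Z.
Proof.
move=> ue [my iy] ceZ; have [[me ie] _] := ue; have [mZ [iZ [iX _]]] := ceZ.
split; first exact: rmeas_measurable mZ.
suff : intg P (fun w => (1 * Z w) ^+ 2) by under eq_fun do rewrite mul1r.
apply: (@intg_sq_mul_trunc _ _ _ _ _ _ (\int[P]_w (y w ^+ 2))) => //.
  exact: rmeas_measurable mZ.
move=> k; pose b := trunc k%:R Z.
have mb : rmeas G b by exact: rmeas_trunc.
have mb' := rmeas_measurable GM mb.
have bk w : `|b w| <= k%:R by exact: trunc_bounded.
have ib2 := intg_trunc_sq k mZ.
have [[_ ib] eb] := trunc_noise k ue mZ.
under eq_integral do rewrite mul1r.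
rewrite -[leLHS]fineK ?lee_fin; last exact: integrable_fin_num.
rewrite -/(Rintegral _ _ _).
have ibX := intg_bounded_mul mb' bk iX.
have e1 : \int[P]_w (b w ^+ 2) = \int[P]_w (b w * (e w * y w)).
  rewrite (cexp_pullout sG GM ceZ)//; last exact: intg_bounded_mul bk iZ.
  apply: eq_Rintegral => w _; rewrite /b /trunc; case: ifP => _ //.
  by rewrite expr0n mul0r.
have : \int[P]_w (2 * (b w * (e w * y w))) <=
       \int[P]_w (y w ^+ 2 + (e w * b w) ^+ 2).
  apply: le_Rintegral => //; [exact: intgZ|exact: intgD|].
  move=> w _; rewrite -subr_ge0.
  suff -> : y w ^+ 2 + (e w * b w) ^+ 2 - 2 * (b w * (e w * y w)) =
    (y w - e w * b w) ^+ 2 by exact: sqr_ge0.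
  by ring.
rewrite RintegralZl// RintegralD// eb -e1 -/b; lra.
Qed.

Lemma cexpD X X' Z Z' : cexp P G X Z -> cexp P G X' Z' ->
  cexp P G (fun w => X w + X' w) (fun w => Z w + Z' w).
Proof.
move=> [mZ [iZ [iX XZ]]] [mZ' [iZ' [iX' XZ']]].
split; [exact: rmeasD|split; [exact: intgD|split; [exact: intgD|]]].
move=> A GA; have mA := GM GA.
rewrite !integralD_EFin// ?XZ ?XZ'//; exact: (integrableS measurableT).
Qed.

Lemma cexpZ (a : R) X Z : cexp P G X Z ->
  cexp P G (fun w => a * X w) (fun w => a * Z w).
Proof.
move=> [mZ [iZ [iX XZ]]].
split; [by apply: rmeasM => //; exact: rmeas_cst|].
split; [exact: intgZ|split; [exact: intgZ|]].
move=> A GA; have mA := GM GA.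
under eq_integral do rewrite EFinM.
under [in RHS]eq_integral do rewrite EFinM.
rewrite !integralZl// ?XZ//; exact: (integrableS measurableT).
Qed.

End ConditionalExpectation.

(** * The completed filtration *)

Section CompletedFiltration.
Context {R : realType} {d : measure_display} {T : measurableType d}
  (P : probability T R).
Hypothesis Pc : measure_is_complete P.

Lemma completionE (G : set (set T)) A : completion P G A <->
  exists B, G B /\ P.-negligible ((A `\` B) `|` (B `\` A)).
Proof.
split=> [[B [M [GB [mM [M0 AB]]]]]|[B [GB [M [mM M0 AB]]]]].
  by exists B; split => //; exists M.
by exists B, M.
Qed.

Lemma sigma_algebra_completion (G : set (set T)) :
  sigma_algebra setT G -> sigma_algebra setT (completion P G).
Proof.
move=> [G0 GC GU]; split.
- apply/completionE; exists set0; split => //.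
  by rewrite setD0 setU0; exact: negligible_set0.
- move=> A /completionE[B [GB AB]]; apply/completionE.
  exists (setT `\` B); split; first exact: GC.
  apply: negligibleS AB => w [] [] [_ h1] h2.
    by right; split => //; apply: contrapT => h; apply: h2.
  by left; split => //; apply: contrapT => h; apply: h2.
- move=> A hA.
  have /choice[B hB] : forall i, exists B,
      G B /\ P.-negligible ((A i `\` B) `|` (B `\` A i)).
    by move=> i; exact/completionE.
  apply/completionE; exists (\bigcup_i B i); split.
    by apply: GU => i; exact: (hB i).1.
  apply: negligibleS (negligible_bigcup (fun i => (hB i).2)).
  move=> w [[[i _ Ai] nB]|[[i _ Bi] nA]]; exists i => //.
    by left; split => // Bi; apply: nB; exists i.
  by right; split => // Ai; apply: nA; exists i.
Qed.

(** [A] is recovered from [B] by removing and adding negligible sets, which are measurable because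
    [P] is complete. *)
Lemma completion_measurable (G : set (set T)) :
  G `<=` measurable -> completion P G `<=` measurable.
Proof.
move=> GM A /completionE[B [GB AB]].
have -> : A = (B `\` (B `\` A)) `|` (A `\` B).
  by rewrite setDD setDE setIC -setIUr setUv setIT.
apply: measurableU.
  apply: measurableD; first exact: GM.
  by apply: Pc; apply: negligibleS AB; exact: subsetUr.
by apply: Pc; apply: negligibleS AB; exact: subsetUl.
Qed.

Lemma sub_completion (G : set (set T)) : G `<=` completion P G.
Proof.
move=> A GA; apply/completionE; exists A; split => //.
by rewrite setDv setU0; exact: negligible_set0.
Qed.

Variable om : nat -> T -> R.
Hypothesis mom : forall k, measurable_fun setT (om k).

Lemma sigma_algebra_Fm k : sigma_algebra setT (Fm P om k).
Proof. exact/sigma_algebra_completion/smallest_sigma_algebra. Qed.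

Lemma Fm_measurable k : Fm P om k `<=` measurable.
Proof.
apply: completion_measurable; apply: smallest_sub.
  exact: sigma_algebra_measurable.
by move=> A [j [_ [B [mB ->]]]]; rewrite -[X in measurable X]setTI; exact: mom.
Qed.

Lemma FmS k : Fm P om k `<=` Fm P om k.+1.
Proof.
move=> A /completionE[B [GB AB]]; apply/completionE; exists B; split => //.
apply: sub_sigma_algebra2 GB => E [j [jk hE]]; exists j; split => //.
exact: ltnW.
Qed.

(** Mind the shift: [Fm P om k] stands for F_{k-1}, so [om k] is only measurable one index later. *)
Lemma rmeas_om k : rmeas (Fm P om k.+1) (om k).
Proof.
move=> B mB; apply: sub_completion; apply: sub_sigma_algebra.
by exists k; split => //; exists B.
Qed.

End CompletedFiltration.

(** * The scalar product and the Schur complement *)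

Section Dot.
Context {R : realType}.

Definition dot {p : nat} (x y : 'cV[R]_p) : R := (x^T *m y) 0 0.

Lemma dotE p (x y : 'cV[R]_p) : dot x y = \sum_i x i 0 * y i 0.
Proof. by rewrite /dot mxE; apply: eq_bigr => i _; rewrite mxE. Qed.

Lemma dotC p (x y : 'cV[R]_p) : dot x y = dot y x.
Proof. by rewrite !dotE; apply: eq_bigr => i _; rewrite mulrC. Qed.

Lemma dotDr p (x y z : 'cV[R]_p) : dot x (y + z) = dot x y + dot x z.
Proof. by rewrite /dot mulmxDr mxE. Qed.

Lemma dotDl p (x y z : 'cV[R]_p) : dot (x + y) z = dot x z + dot y z.
Proof. by rewrite dotC dotDr ![dot z _]dotC. Qed.

Lemma dotZr p a (x y : 'cV[R]_p) : dot x (a *: y) = a * dot x y.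
Proof. by rewrite /dot -scalemxAr mxE. Qed.

Lemma dotZl p a (x y : 'cV[R]_p) : dot (a *: x) y = a * dot x y.
Proof. by rewrite dotC dotZr dotC. Qed.

Lemma dot0r p (x : 'cV[R]_p) : dot x 0 = 0.
Proof. by rewrite /dot mulmx0 mxE. Qed.

Lemma dot_mulmx p r (M : 'M[R]_(r, p)) (x : 'cV[R]_p) (y : 'cV[R]_r) :
  dot (M *m x) y = dot x (M^T *m y).
Proof. by rewrite /dot trmx_mul mulmxA. Qed.

Lemma dot_quad p r (M : 'M[R]_(r, p)) (x : 'cV[R]_p) (y : 'cV[R]_r) :
  (y^T *m M *m x) 0 0 = dot y (M *m x).
Proof. by rewrite /dot mulmxA. Qed.

Lemma dot_ge0 p (x : 'cV[R]_p) : 0 <= dot x x.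
Proof. by rewrite dotE; apply: sumr_ge0 => i _; rewrite -expr2 sqr_ge0. Qed.

Lemma dot_eq0 p (x : 'cV[R]_p) : dot x x = 0 -> x = 0.
Proof.
rewrite dotE => /psumr_eq0P h; apply/matrixP => i j; rewrite (ord1 j) mxE.
have /eqP := h (fun i _ => ltac:(by rewrite -expr2 sqr_ge0)) i isT.
by rewrite mulf_eq0 orbb => /eqP.
Qed.

(** A kernel vector [r] satisfies [delta * dot r r <= 0], hence vanishes. This makes the [invmx] of
    (A3) a true inverse; on singular matrices [invmx] is a dummy value. *)
Lemma posdef_unitmx p (M : 'M[R]_p) (delta : R) : 0 < delta ->
  (forall v : 'cV[R]_p, delta * dot v v <= dot v (M *m v)) -> M \in unitmx.
Proof.
move=> d0 MP; rewrite -unitmx_tr -row_free_unit -kermx_eq0.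
apply/eqP/row_matrixP => i; rewrite row0.
set r := row i _.
have r0 : r *m M^T = 0 by rewrite /r -row_mul mulmx_ker row0.
have Mr : M *m r^T = 0.
  by apply: trmx_inj; rewrite trmx_mul trmxK r0 trmx0.
have := MP r^T; rewrite Mr dot0r => h.
have e0 : dot r^T r^T = 0.
  by apply/eqP; rewrite eq_le dot_ge0 andbT -(pmulr_rle0 _ d0).
by apply: trmx_inj; rewrite trmx0; exact: dot_eq0.
Qed.

(* Completing the square in [v]. *)
Lemma schur_ge0 n m (Q : 'M[R]_n) (S : 'M[R]_(m, n)) (M : 'M[R]_m) (delta : R)
  (z : 'cV[R]_n) (v : 'cV[R]_m) : 0 < delta -> M^T = M ->
  (forall v : 'cV[R]_m, delta * dot v v <= dot v (M *m v)) ->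
  0 <= dot z ((Q - S^T *m invmx M *m S) *m z) ->
  0 <= dot z (Q *m z) + 2 * dot v (S *m z) + dot v (M *m v).
Proof.
move=> d0 MT MP; have uM := posdef_unitmx d0 MP.
(* [- t] minimises the form in [v]. The form equals its Schur complement part in [z] plus
   [dot (v + t) (M *m (v + t))], and coercivity makes the latter nonnegative. *)
pose t := invmx M *m (S *m z).
have Mt : M *m t = S *m z by rewrite /t mulKVmx.
have -> : (Q - S^T *m invmx M *m S) *m z = Q *m z - S^T *m t.
  by rewrite mulmxBl /t !mulmxA.
rewrite dotDr -scaleN1r dotZr mulN1r -dot_mulmx -Mt => h.
have := le_trans (mulr_ge0 (ltW d0) (dot_ge0 (v + t))) (MP (v + t)).
rewrite mulmxDr !dotDl !dotDr.
have -> : dot t (M *m v) = dot v (M *m t) by rewrite dotC dot_mulmx MT.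
have -> : dot t (M *m t) = dot (M *m t) t by rewrite dotC.
lra.
Qed.

End Dot.

(** * Square-integrable vectors *)

Section VectorL2.
Context {R : realType} {d : measure_display} {T : measurableType d}
  (P : probability T R).

Lemma L2vP p (X : T -> 'cV[R]_p) :
  L2v P X <-> forall i, sqintg P (fun w => X w i 0).
Proof.
split=> [[mX iX] i|hX].
  by split; [move=> _ B mB; rewrite setTI; exact: mX|exact: iX].
split=> i; last exact: (hX i).2.
by move=> B mB; rewrite -[X in measurable X]setTI; exact: ((hX i).1 measurableT B mB).
Qed.

Lemma L2vD p (X Y : T -> 'cV[R]_p) :
  L2v P X -> L2v P Y -> L2v P (fun w => X w + Y w).
Proof.
move=> /L2vP hX /L2vP hY; apply/L2vP => i.
by under eq_fun do rewrite mxE; exact: sqintgD.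
Qed.

Lemma L2vZ p (a : R) (X : T -> 'cV[R]_p) : L2v P X -> L2v P (fun w => a *: X w).
Proof.
by move=> /L2vP hX; apply/L2vP => i; under eq_fun do rewrite mxE; exact: sqintgZ.
Qed.

Lemma L2v0 p : L2v P (fun _ : T => 0 : 'cV[R]_p).
Proof. by apply/L2vP => i; under eq_fun do rewrite mxE; exact: sqintg0. Qed.

Lemma L2v_mulmx p r (M : 'M[R]_(r, p)) (X : T -> 'cV[R]_p) :
  L2v P X -> L2v P (fun w => M *m X w).
Proof.
move=> /L2vP hX; apply/L2vP => i; under eq_fun do rewrite mxE.
by apply: sqintg_sum => j _; exact: sqintgZ.
Qed.

Lemma intg_dot p (X Y : T -> 'cV[R]_p) :
  L2v P X -> L2v P Y -> intg P (fun w => dot (X w) (Y w)).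
Proof.
move=> /L2vP hX /L2vP hY; under eq_fun do rewrite dotE.
by apply: intg_sum => i _; exact: sqintgM.
Qed.

Lemma eq_Rintegral_ae (f g : T -> R) : intg P f -> intg P g ->
  {ae P, forall w, f w = g w} -> \int[P]_w f w = \int[P]_w g w.
Proof.
move=> fi gi fg; congr fine; apply: ae_eq_integral => //.
- exact: measurable_int fi.
- exact: measurable_int gi.
- by apply: filterS fg => w -> _.
Qed.

Section Conditional.
Variable G : set (set T).
Hypotheses (sG : sigma_algebra setT G) (GM : G `<=` measurable).

Definition L2G p (X : T -> 'cV[R]_p) := vmeas G X /\ L2v P X.

Lemma L2GD p (X Y : T -> 'cV[R]_p) : L2G X -> L2G Y -> L2G (fun w => X w + Y w).
Proof.
move=> [mX iX] [mY iY]; split; last exact: L2vD.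
by move=> i; under eq_fun do rewrite mxE; exact: rmeasD.
Qed.

Lemma L2GZ p (a : R) (X : T -> 'cV[R]_p) : L2G X -> L2G (fun w => a *: X w).
Proof.
move=> [mX iX]; split; last exact: L2vZ.
by move=> i; under eq_fun do rewrite mxE; apply: rmeasM => //; exact: rmeas_cst.
Qed.

Lemma L2G0 p : L2G (fun _ : T => 0 : 'cV[R]_p).
Proof.
split; last exact: L2v0.
by move=> i; under eq_fun do rewrite mxE; exact: rmeas_cst.
Qed.

Lemma L2G_mulmx p r (M : 'M[R]_(r, p)) (X : T -> 'cV[R]_p) :
  L2G X -> L2G (fun w => M *m X w).
Proof.
move=> [mX iX]; split; last exact: L2v_mulmx.
move=> i; under eq_fun do rewrite mxE.
by apply: rmeas_sum => // j; apply: rmeasM => //; exact: rmeas_cst.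
Qed.

Lemma L2v_noise p e (X : T -> 'cV[R]_p) : unit_variance P G e -> L2G X ->
  L2v P (fun w => e w *: X w).
Proof.
move=> ue [mX /L2vP iX]; apply/L2vP => i; under eq_fun do rewrite mxE.
exact: (sqintg_noise sG GM ue (mX i) (iX i)).
Qed.

Lemma cexpv_L2G p e (y Z : T -> 'cV[R]_p) : unit_variance P G e -> L2v P y ->
  cexpv P G (fun w => e w *: y w) Z -> L2G Z.
Proof.
move=> ue /L2vP hy hZ; split; first by move=> i; exact: (hZ i).1.
apply/L2vP => i; have := hZ i; under eq_fun do rewrite mxE.
exact: (cexp_sqintg sG GM ue (hy i)).
Qed.

(** Puts the plain conditional expectation into the shape [e w *: y w] with [e] constant 1, so that
    the noise lemmas apply to it. *)
Lemma cexpv1 p (y Z : T -> 'cV[R]_p) : cexpv P G y Z ->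
  cexpv P G (fun w => (fun=> 1) w *: y w) Z.
Proof. by move=> h; under eq_fun do rewrite scale1r. Qed.

Lemma cexpv_L2G1 p (y Z : T -> 'cV[R]_p) : L2v P y -> cexpv P G y Z -> L2G Z.
Proof.
move=> hy hZ; apply: (cexpv_L2G (unit_variance1 P GM) hy); exact: cexpv1.
Qed.

(** Componentwise pull-out with an unbounded factor: [h * (e * y)] is integrable because it regroups
    as [(e * h) * y], where [e * h] is square-integrable by the isometry. *)
Lemma cexpv_dot p e (h y Z : T -> 'cV[R]_p) : unit_variance P G e -> L2G h ->
  L2v P y -> cexpv P G (fun w => e w *: y w) Z ->
  \int[P]_w dot (e w *: h w) (y w) = \int[P]_w dot (h w) (Z w).
Proof.
move=> ue hh hy hZ; have [_ /L2vP iZ] := cexpv_L2G ue hy hZ.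
have /L2vP ieh := L2v_noise ue hh; case: hh => [mh /L2vP ih].
move/L2vP : hy => hy.
under eq_Rintegral do rewrite dotE.
under [in RHS]eq_Rintegral do rewrite dotE.
have ieh' i : intg P (fun w => h w i 0 * (e w * y w i 0)).
  have := sqintgM (ieh i) (hy i); congr intg; apply/funext => w.
  by rewrite mxE; ring.
rewrite !Rintegral_sum.
- apply: eq_bigr => i _.
  have ci : cexp P G (fun w => e w * y w i 0) (fun w => Z w i 0).
    by have := hZ i; under eq_fun do rewrite mxE.
  rewrite -(cexp_pullout sG GM ci)//; last exact: sqintgM.
  by apply: eq_Rintegral => w _; rewrite mxE; ring.
- by move=> i _; exact: sqintgM.
- by move=> i _; exact: sqintgM.
Qed.

Lemma cexpv_dot1 p (h y Z : T -> 'cV[R]_p) : L2G h -> L2v P y ->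
  cexpv P G y Z -> \int[P]_w dot (h w) (y w) = \int[P]_w dot (h w) (Z w).
Proof.
move=> hh hy hZ; rewrite -(cexpv_dot (unit_variance1 P GM) hh hy (cexpv1 hZ)).
by apply: eq_Rintegral => w _; rewrite scale1r.
Qed.

Lemma cexpv_exists p e (y : T -> 'cV[R]_p) : sqintg P e -> L2v P y ->
  exists Z, cexpv P G (fun w => e w *: y w) Z.
Proof.
move=> he /L2vP hy.
have /choice[Z hZ] : forall i, exists Z, cexp P G (fun w => (e w *: y w) i 0) Z.
  move=> i; apply: (cexp_exists sG GM); under eq_fun do rewrite mxE.
  exact: sqintgM.
exists (fun w => \col_i Z i w) => i.
by under [X in cexp _ _ _ X]eq_fun do rewrite mxE.
Qed.

Lemma cexpv_comb p (a : R) (X X' Z Z' : T -> 'cV[R]_p) :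
  cexpv P G X Z -> cexpv P G X' Z' ->
  cexpv P G (fun w => X w + a *: X' w) (fun w => Z w + a *: Z' w).
Proof.
move=> h h' i.
have := cexpD sG GM (h i) (cexpZ sG GM a (h' i)).
congr cexp; apply/funext => w; by rewrite !mxE.
Qed.

End Conditional.

Lemma L2GS (G G' : set (set T)) p (X : T -> 'cV[R]_p) :
  G `<=` G' -> L2G G X -> L2G G' X.
Proof. by move=> GG' [mX iX]; split => // i B mB; apply: GG'; exact: mX. Qed.

End VectorL2.

(** * Solutions of the state equation *)

Section States.
Context {R : realType} {d : measure_display} {T : measurableType d}
  (P : probability T R) (om : nat -> T -> R) (N n m : nat)
  (A C : nat -> 'M[R]_n) (B : nat -> 'M[R]_(n, m)).
Hypotheses (Pc : measure_is_complete P)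
  (mom : forall k, measurable_fun setT (om k))
  (uv : forall k, (k < N)%N -> unit_variance P (Fm P om k) (om k)).
Implicit Types (q y z ybar zbar : nat -> T -> 'cV[R]_n) (xi : T -> 'cV[R]_n)
  (u v : nat -> T -> 'cV[R]_m).

Local Notation state := (is_state P om N A C B).
Let sF k : sigma_algebra setT (Fm P om k) := sigma_algebra_Fm P om k.
Let Fme k : Fm P om k `<=` measurable := Fm_measurable Pc mom (k:=k).

Lemma state_ybar q xi u y ybar k : state q xi u y ybar -> (k < N)%N ->
  L2G P (Fm P om k) (ybar k).
Proof.
move=> [hy [_ hs]] kN; have [hb _] := hs k kN.
exact: (cexpv_L2G1 (sF k) (@Fme k) (hy k.+1 kN).2 hb).
Qed.

(** Sources and terminal values are combined as well, so this one lemma covers both perturbing a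
    state by a homogeneous solution and subtracting two states. *)
Lemma state_comb q q' xi xi' u u' y y' ybar ybar' (a : R) :
  state q xi u y ybar -> state q' xi' u' y' ybar' ->
  state (fun k w => q k w + a *: q' k w) (fun w => xi w + a *: xi' w)
    (fun k w => u k w + a *: u' k w) (fun k w => y k w + a *: y' k w)
    (fun k w => ybar k w + a *: ybar' k w).
Proof.
move=> [hy [yN hs]] [hy' [yN' hs']]; split; [|split].
- move=> k kN; apply: (L2GD (sF k)); first exact: hy.
  by apply: (L2GZ (sF k)); exact: hy'.
- by apply: filterS2 yN yN' => w -> ->.
- move=> k kN; have [hb [yw [hw e]]] := hs k kN.
  have [hb' [yw' [hw' e']]] := hs' k kN.
  split; first exact: (cexpv_comb (sF k) (@Fme k) a hb hb').
  exists (fun w => yw w + a *: yw' w); split.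
    have := cexpv_comb (sF k) (@Fme k) a hw hw'; congr cexpv.
    by apply/funext => w; rewrite scalerDr !scalerA mulrC.
  apply: filterS2 e e' => w -> ->.
  rewrite !mulmxDr -!scalemxAr.
  move: (A k *m _) (A k *m _) (B k *m _) (B k *m _) (C k *m _) (C k *m _).
  by move=> a1 a2 b1 b2 c1 c2; apply/matrixP => i j; rewrite !mxE; ring.
Qed.

Lemma state_perturb q xi u v y z ybar zbar (a : R) :
  state q xi u y ybar -> state (fun _ _ => 0) (fun=> 0) v z zbar ->
  state q xi (fun k w => u k w + a *: v k w) (fun k w => y k w + a *: z k w)
    (fun k w => ybar k w + a *: zbar k w).
Proof.
move=> hs hz.
have Eq : (fun k w => q k w + a *: (0 : 'cV[R]_n)) = q.
  by apply/funext => k; apply/funext => w; rewrite scaler0 addr0.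
have Exi : (fun w => xi w + a *: (0 : 'cV[R]_n)) = xi.
  by apply/funext => w; rewrite scaler0 addr0.
rewrite -[q]Eq -[xi]Exi; exact: (state_comb a hs hz).
Qed.

Lemma state_sub q xi u u' y y' ybar ybar' :
  state q xi u y ybar -> state q xi u' y' ybar' ->
  state (fun _ _ => 0) (fun=> 0) (fun k w => u k w + (-1) *: u' k w)
    (fun k w => y k w + (-1) *: y' k w) (fun k w => ybar k w + (-1) *: ybar' k w).
Proof.
move=> hs hs'.
have Eq : (fun k w => q k w + (-1) *: q k w) = (fun _ _ => 0).
  by apply/funext => k; apply/funext => w; rewrite scaleN1r subrr.
have Exi : (fun w => xi w + (-1) *: xi w) = (fun=> 0).
  by apply/funext => w; rewrite scaleN1r subrr.
rewrite -Eq -Exi; exact: (state_comb (-1) hs hs').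
Qed.

Lemma state_exists v : admissible P om N v ->
  exists z zbar, state (fun _ _ => 0) (fun=> 0) v z zbar.
Proof.
move=> av.
(* The integrability hypotheses sit inside the existential, so one use of choice yields a total
   conditional expectation operator; it returns 0 outside its domain. *)
have /choice[ce hce] : forall ke : nat * (T -> R) * (T -> 'cV[R]_n), exists Z,
    sqintg P ke.1.2 -> L2v P ke.2 ->
    cexpv P (Fm P om ke.1.1) (fun w => ke.1.2 w *: ke.2 w) Z.
  move=> [[k e] y]; have [h1|h1] := pselect (sqintg P e); last by exists (fun=> 0).
  have [h2|h2] := pselect (L2v P y); last by exists (fun=> 0).
  have [Z hZ] := cexpv_exists (sF k) (@Fme k) h1 h2.
  by exists Z.
(* One backward step of the state equation; the final [+ 0] is the vanishing source, kept to match
   [is_state]. *)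
pose back k (y : T -> 'cV[R]_n) w := A k *m ce (k, fun=> 1, y) w + B k *m v k w
   + C k *m ce (k, om k, y) w + 0.
(* The recursion counts the remaining steps: [zr j] is the state at time [N - j], starting from the
   terminal value 0. *)
pose zr := fix zr j := if j is i.+1 then back (N - i.+1)%N (zr i) else fun=> 0.
pose z k := zr (N - k)%N.
have zS k : (k < N)%N -> z k = back k (z k.+1).
  move=> kN; rewrite /z -{1}(@subnSK k N)//= ; congr back; lia.
have s1 : sqintg P (fun=> 1) := (unit_variance1 P (Fme (k:=0%N))).1.
have hz j : (j <= N)%N -> L2G P (Fm P om (N - j)) (z (N - j)%N).
  elim: j => [_|j IH jN].
    by rewrite subn0 /z subnn; exact: L2G0.
  have kN : (N - j.+1 < N)%N by lia.
  have := IH (ltnW jN); rewrite -(subnSK jN) => -[_ hk].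
  rewrite zS//; set k := (N - j.+1)%N in kN hk *.
  have h1 := hce (k, fun=> 1, z k.+1) s1 hk.
  have h2 := hce (k, om k, z k.+1) (uv kN).1 hk.
  have l1 := cexpv_L2G (sF k) (@Fme k) (unit_variance1 P (@Fme k)) hk h1.
  have l2 := cexpv_L2G (sF k) (@Fme k) (uv kN) hk h2.
  rewrite /back; do !apply: (L2GD (sF k)); last exact: L2G0.
  - exact: (L2G_mulmx (sF k)).
  - by apply: (L2G_mulmx (sF k)); exact: av.
  - exact: (L2G_mulmx (sF k)).
have hz' k : (k <= N)%N -> L2G P (Fm P om k) (z k).
  by move=> kN; rewrite -(subKn kN); apply: hz; exact: leq_subr.
exists z, (fun k => ce (k, fun=> 1, z k.+1)); split; [|split].
- exact: hz'.
- by apply: aeW => w; rewrite /z subnn.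
- move=> k kN; have [_ hk] := hz' _ kN; split.
    have := hce (k, fun=> 1, z k.+1) s1 hk => /=; congr cexpv.
    by apply/funext => w; rewrite scale1r.
  exists (ce (k, om k, z k.+1)); split; first exact: (hce (k, om k, z k.+1) (uv kN).1 hk).
  by apply: aeW => w; rewrite zS.
Qed.

End States.

(** * Duality and expansion of the cost *)

Section Cost.
Context {R : realType} {d : measure_display} {T : measurableType d}
  (P : probability T R) (om : nat -> T -> R) (N n m : nat)
  (A C : nat -> 'M[R]_n) (B : nat -> 'M[R]_(n, m))
  (G0 : 'M[R]_n) (Q : nat -> 'M[R]_n) (Rm : nat -> 'M[R]_m)
  (S : nat -> 'M[R]_(m, n)) (eta : nat -> T -> 'cV[R]_n)
  (rho : nat -> T -> 'cV[R]_m).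
Hypotheses (Pc : measure_is_complete P)
  (mom : forall k, measurable_fun setT (om k))
  (uv : forall k, (k < N)%N -> unit_variance P (Fm P om k) (om k)).
Hypotheses (G0T : G0^T = G0)
  (QT : forall k, (k < N)%N -> (Q k)^T = Q k)
  (RT : forall k, (k < N)%N -> (Rm k)^T = Rm k)
  (hetarho : forall k, (k < N)%N -> L2v P (eta k) /\ L2v P (rho k)).
Implicit Types (q x y z ybar zbar : nat -> T -> 'cV[R]_n) (xi : T -> 'cV[R]_n)
  (u v : nat -> T -> 'cV[R]_m).

Local Notation state := (is_state P om N A C B).
Let sF k : sigma_algebra setT (Fm P om k) := sigma_algebra_Fm P om k.
Let Fme k : Fm P om k `<=` measurable := Fm_measurable Pc mom (k:=k).

(** Half the gradient of the running cost with respect to [ybar]. *)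
Definition adjoint_source u ybar k w : 'cV[R]_n :=
  Q k *m ybar k w + (S k)^T *m u k w + eta k w.

Definition stationarity u x ybar k w : 'cV[R]_m :=
  (B k)^T *m x k w + S k *m ybar k w + Rm k *m u k w + rho k w.

(** The forward half of the Hamiltonian system for given [u] and [ybar]; its initial condition is
    imposed separately. *)
Definition adjoint u x ybar :=
  (forall k, (k <= N)%N -> L2G P (Fm P om k) (x k)) /\
  forall k, (k < N)%N -> {ae P, forall w, x k.+1 w =
    (A k)^T *m x k w + adjoint_source u ybar k w + om k w *: ((C k)^T *m x k w)}.

Definition quad_cost v z zbar (w : T) : R :=
  cost_integrand N G0 Q Rm S (fun _ _ => 0) (fun _ _ => 0) v z zbar w.

(** Half the directional derivative of the cost integrand at [(u, y, ybar)] along [(v, z, zbar)]. *)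
Definition first_variation u y ybar v z zbar w : R :=
  dot (G0 *m y 0 w) (z 0 w) + \sum_(k < N)
   (dot (adjoint_source u ybar k w) (zbar k w)
    + dot (S k *m ybar k w + Rm k *m u k w + rho k w) (v k w)).

(** A pointwise algebraic identity: symmetry of [G0], [Q k] and [Rm k] merges the two cross terms of
    each quadratic form. *)
Lemma cost_expansion u y ybar v z zbar (a : R) w :
  cost_integrand N G0 Q Rm S eta rho (fun k w => u k w + a *: v k w)
    (fun k w => y k w + a *: z k w) (fun k w => ybar k w + a *: zbar k w) w =
  cost_integrand N G0 Q Rm S eta rho u y ybar w
  + 2 * a * first_variation u y ybar v z zbar w
  + a ^+ 2 * quad_cost v z zbar w.
Proof.
rewrite /quad_cost /cost_integrand /first_variation /adjoint_source.
have sym p (M : 'M[R]_p) (s t : 'cV[R]_p) : M^T = M ->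
    dot (s + a *: t) (M *m (s + a *: t)) =
    dot s (M *m s) + 2 * a * dot (M *m s) t + a ^+ 2 * dot t (M *m t).
  move=> MT; rewrite mulmxDr -scalemxAr !dotDl !dotDr !dotZl !dotZr.
  rewrite [dot (M *m s) t]dotC.
  have -> : dot s (M *m t) = dot t (M *m s) by rewrite dotC dot_mulmx MT.
  by ring.
rewrite !dot_quad sym// !mulrDr !mulr_sumr.
set l := \sum_(_ < _) _; set r1 := \sum_(_ < _) _.
set r2 := \sum_(_ < _) _; set r3 := \sum_(_ < _) _.
suff -> : l = r1 + r2 + r3 by ring.
rewrite /l /r1 /r2 /r3 -!big_split /=; apply: eq_bigr => k _.
rewrite !dot_quad -!/(dot _ _) !sym ?QT ?RT//.
rewrite mulmxDr -scalemxAr !dotDl !dotDr !dotZl !dotZr.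
rewrite ![dot 0 _]dotC !dot0r [dot ((S k)^T *m _) _]dot_mulmx trmxK.
rewrite [dot (S k *m ybar k w) _]dotC.
by ring.
Qed.


Lemma intg_cost u y ybar : L2v P (y 0) ->
  (forall k, (k < N)%N -> L2v P (u k) /\ L2v P (ybar k)) ->
  intg P (cost_integrand N G0 Q Rm S eta rho u y ybar).
Proof.
move=> hy hk; rewrite /cost_integrand; under eq_fun do rewrite dot_quad.
apply: intgD; first by apply: intg_dot => //; exact: L2v_mulmx.
apply: intg_sum => k _; have kN := ltn_ord k.
have [hu hb] := hk k kN; have [he hr] := hetarho kN.
under eq_fun do rewrite !dot_quad -!/(dot _ _).
do !apply: intgD; do ?apply: intgZ; apply: intg_dot => //; exact: L2v_mulmx.
Qed.

(** [cost_is] equates extended reals; integrability of the integrand allows computing with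
    real-valued integrals instead. *)
Lemma cost_isE q xi u (c : R) : admissible P om N u ->
  cost_is P om N A C B q G0 Q Rm S eta rho xi u c <->
  exists y ybar, state q xi u y ybar /\
    c = 2^-1 * \int[P]_w cost_integrand N G0 Q Rm S eta rho u y ybar w.
Proof.
move=> au; have icost y ybar : state q xi u y ybar ->
    intg P (cost_integrand N G0 Q Rm S eta rho u y ybar).
  move=> hs; apply: intg_cost; first exact: (hs.1 0%N _).2.
  by move=> k kN; split; [exact: (au k kN).2|exact: (state_ybar Pc mom hs kN).2].
have E y ybar : state q xi u y ybar ->
    (2^-1 * \int[P]_w cost_integrand N G0 Q Rm S eta rho u y ybar w)%:E =
    ((2^-1)%:E * \int[P]_w (cost_integrand N G0 Q Rm S eta rho u y ybar w)%:E)%E.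
  move=> hs; rewrite EFinM /Rintegral fineK//.
  exact: integrable_fin_num (icost _ _ hs).
split=> [[y [ybar [hs cE]]]|[y [ybar [hs ->]]]]; exists y, ybar; split => //.
  by apply: EFin_inj; rewrite cE E.
by rewrite E.
Qed.

Lemma intg_first_variation u y ybar v z zbar :
  L2v P (y 0) -> L2v P (z 0) ->
  (forall k, (k < N)%N ->
    [/\ L2v P (u k), L2v P (ybar k), L2v P (v k) & L2v P (zbar k)]) ->
  intg P (first_variation u y ybar v z zbar).
Proof.
move=> hy hz hk.
apply: intgD; first by apply: intg_dot => //; exact: L2v_mulmx.
apply: intg_sum => k _; have kN := ltn_ord k.
have [hu hb hv hzb] := hk k kN; have [he hr] := hetarho kN.
apply: intgD; apply: intg_dot => //; do ?apply: L2vD => //; exact: L2v_mulmx.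
Qed.

(* The noise term of [x k.+1] is paired with [z k.+1] through [E_{k-1}[z_{k+1} w_k]]
   and the remaining terms through [E_{k-1}[z_{k+1}]], so that the linear
   equation of [z] brings the pairing back to time [k]. *)
Lemma duality_step u ybar x v z zbar k : (k < N)%N ->
  L2G P (Fm P om k) (u k) -> L2G P (Fm P om k) (ybar k) ->
  L2G P (Fm P om k) (eta k) -> L2v P (v k) ->
  adjoint u x ybar -> state (fun _ _ => 0) (fun=> 0) v z zbar ->
  \int[P]_w dot (x k.+1 w) (z k.+1 w) + \int[P]_w dot ((B k)^T *m x k w) (v k w) =
  \int[P]_w dot (x k w) (z k w) + \int[P]_w dot (adjoint_source u ybar k w) (zbar k w).
Proof.
move=> kN hu hb he hv [hx ex] hs; have hzb := state_ybar Pc mom hs kN.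
have [hz [_ hs']] := hs; have [cb [zw [cw ez]]] := hs' k kN.
have [hx0 [_ hx1]] := (hx k (ltnW kN), hx k.+1 kN).
have [hz0 [_ hz1]] := (hz k (ltnW kN), hz k.+1 kN).
have hphi : L2G P (Fm P om k) (adjoint_source u ybar k).
  by do !apply: (L2GD (sF k)) => //; exact: (L2G_mulmx (sF k)).
have hAx := L2G_mulmx (sF k) (A k)^T hx0.
have hCx := L2G_mulmx (sF k) (C k)^T hx0.
have hs1 := L2GD (sF k) hAx hphi.
have hoC := L2v_noise (sF k) (@Fme k) (uv kN) hCx.
have hzw := cexpv_L2G (sF k) (@Fme k) (uv kN) hz1 cw.
rewrite (@eq_Rintegral_ae _ _ _ P _ (fun w =>
  dot ((A k)^T *m x k w + adjoint_source u ybar k w) (z k.+1 w) +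
  dot (om k w *: ((C k)^T *m x k w)) (z k.+1 w))); last first.
- by apply: filterS (ex k kN) => w ->; rewrite -dotDl.
- by apply: intgD; apply: intg_dot => //; exact: hs1.2.
- exact: intg_dot.
rewrite RintegralD//; [|by apply: intg_dot => //; exact: hs1.2|exact: intg_dot].
rewrite (cexpv_dot1 (sF k) (@Fme k) hs1 hz1 cb).
rewrite (cexpv_dot (sF k) (@Fme k) (uv kN) hCx hz1 cw).
have hBx := L2v_mulmx (B k)^T hx0.2.
rewrite -RintegralD//; [|exact: (intg_dot hs1.2 hzb.2)|exact: (intg_dot hCx.2 hzw.2)].
rewrite -RintegralD//; [|apply: intgD;
    [exact: (intg_dot hs1.2 hzb.2)|exact: (intg_dot hCx.2 hzw.2)]
  |exact: intg_dot].
rewrite -RintegralD//; [|exact: (intg_dot hx0.2 hz0.2)|exact: (intg_dot hphi.2 hzb.2)].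
apply: eq_Rintegral_ae.
- apply: intgD; last exact: intg_dot.
  by apply: intgD; [exact: (intg_dot hs1.2 hzb.2)|exact: (intg_dot hCx.2 hzw.2)].
- by apply: intgD; [exact: (intg_dot hx0.2 hz0.2)|exact: (intg_dot hphi.2 hzb.2)].
- apply: filterS ez => w ->; rewrite addr0 !dotDr dotDl !dot_mulmx !trmxK; ring.
Qed.

(** Summing [duality_step] leaves two boundary terms: the one at [N] vanishes since [z N = 0], and
    the one at 0 is the [G0] term of the first variation. The pairings with [zbar] thus become
    pairings of [(B k)^T *m x k] with [v k], the missing summand of [stationarity]. *)
Lemma first_variationE u x y ybar v z zbar :
  (forall k, (k < N)%N -> [/\ L2G P (Fm P om k) (u k), L2G P (Fm P om k) (ybar k),
    L2G P (Fm P om k) (eta k) & L2v P (v k)]) ->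
  {ae P, forall w, x 0 w = G0 *m y 0 w} -> L2v P (y 0) ->
  adjoint u x ybar -> state (fun _ _ => 0) (fun=> 0) v z zbar ->
  \int[P]_w first_variation u y ybar v z zbar w =
  \sum_(k < N) \int[P]_w dot (stationarity u x ybar k w) (v k w).
Proof.
move=> hk x0 hy0 hadj hs.
have [hx _] := hadj; have [hz [zN _]] := hs.
have hzb k (kN : (k < N)%N) := (state_ybar Pc mom hs kN).2.
have telescope j : (j <= N)%N ->
    \int[P]_w dot (x j w) (z j w) +
      \sum_(k < j) \int[P]_w dot ((B k)^T *m x k w) (v k w) =
    \int[P]_w dot (x 0 w) (z 0 w) +
      \sum_(k < j) \int[P]_w dot (adjoint_source u ybar k w) (zbar k w).
  elim: j => [_|j IH jN]; first by rewrite !big_ord0.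
  have [hu hb he hv] := hk j jN.
  have := duality_step jN hu hb he hv hadj hs; have := IH (ltnW jN).
  by rewrite !big_ord_recr /=; lra.
have := telescope N (leqnn N).
have -> : \int[P]_w dot (x N w) (z N w) = 0.
  rewrite (@eq_Rintegral_ae _ _ _ P _ (fun=> 0)).
  - by rewrite /Rintegral integral0.
  - exact: intg_dot (hx N _).2 (hz N _).2.
  - exact: integrable0.
  - by apply: filterS zN => w ->; rewrite dot0r.
have -> : \int[P]_w dot (x 0 w) (z 0 w) = \int[P]_w dot (G0 *m y 0 w) (z 0 w).
  apply: eq_Rintegral_ae.
  - by apply: intg_dot; [exact: (hx 0%N _).2|exact: (hz 0%N _).2].
  - by apply: intg_dot; [exact: L2v_mulmx|exact: (hz 0%N _).2].
  - by apply: filterS x0 => w ->.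
rewrite add0r => tel.
have isrc k : (k < N)%N -> L2v P (adjoint_source u ybar k).
  move=> kN; have [hu hb he hv] := hk k kN.
  by do !apply: L2vD; try exact: L2v_mulmx hb.2; try exact: L2v_mulmx hu.2; exact: he.2.
have iS k : (k < N)%N -> L2v P (fun w => S k *m ybar k w + Rm k *m u k w + rho k w).
  move=> kN; have [hu hb he hv] := hk k kN.
  do !apply: L2vD; [exact: L2v_mulmx hb.2|exact: L2v_mulmx hu.2|exact: (hetarho kN).2].
rewrite /first_variation RintegralD//; first last.
- apply: intg_sum => k _; have kN := ltn_ord k; have [hu hb he hv] := hk k kN.
  by apply: intgD; apply: intg_dot => //; [exact: isrc|exact: hzb|exact: iS].
- by apply: intg_dot; [exact: L2v_mulmx|exact: (hz 0%N _).2].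
rewrite Rintegral_sum; last first.
  move=> k _; have kN := ltn_ord k; have [hu hb he hv] := hk k kN.
  by apply: intgD; apply: intg_dot => //; [exact: isrc|exact: hzb|exact: iS].
rewrite (eq_bigr (fun k : 'I_N =>
  \int[P]_w dot (adjoint_source u ybar k w) (zbar k w) +
  \int[P]_w dot (S k *m ybar k w + Rm k *m u k w + rho k w) (v k w))); last first.
  move=> k _; have kN := ltn_ord k; have [hu hb he hv] := hk k kN.
  by rewrite RintegralD//; apply: intg_dot => //; [exact: isrc|exact: hzb|exact: iS].
rewrite big_split /= addrA -tel -big_split /=; apply: eq_bigr => k _.
have kN := ltn_ord k; have [hu hb he hv] := hk k kN.
rewrite -RintegralD//; first last.
- by apply: intg_dot => //; exact: iS.
- by apply: intg_dot => //; apply: L2v_mulmx; exact: (hx k (ltnW kN)).2.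
by apply: eq_Rintegral => w _; rewrite -dotDl /stationarity !addrA.
Qed.

End Cost.

(** * Necessity and sufficiency *)

(** Test at [a = - F / D]. The choice [D = K ^+ 2 + 1] is positive and exceeds [K] whatever the sign
    of [K], and the value there is [- F ^+ 2 * (D - K) / D ^+ 2]. *)
Lemma linear_coef_eq0 {R : realFieldType} (F K : R) :
  (forall a, 0 <= a * F + a ^+ 2 * K) -> F = 0.
Proof.
move=> h; pose D := K ^+ 2 + 1; have D0 : 0 < D by rewrite /D; nra.
have := h (- F / D).
have -> : - F / D * F + (- F / D) ^+ 2 * K = - (F ^+ 2 * (D - K)) / D ^+ 2.
  by field; rewrite gt_eqF.
rewrite mulNr oppr_ge0 pmulr_lle0 ?invr_gt0 ?exprn_gt0// => h2.
have DK : 0 < D - K by rewrite /D; nra.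
have : F ^+ 2 <= 0 by rewrite -(pmulr_lle0 _ DK).
by rewrite le_eqVlt ltNge sqr_ge0 orbF sqrf_eq0 => /eqP.
Qed.

Lemma Rintegral_dot_eq0 {R : realType} {d} {T : measurableType d}
  (P : probability T R) p (D : T -> 'cV[R]_p) : L2v P D ->
  \int[P]_w dot (D w) (D w) = 0 -> {ae P, forall w, D w = 0}.
Proof.
move=> hD; have iD := intg_dot hD hD => D0.
have mD := measurable_int _ iD.
have : (\int[P]_w `|(EFin \o (fun w => dot (D w) (D w))) w| = 0)%E.
  rewrite (eq_integral (fun w => (dot (D w) (D w))%:E)); last first.
    by move=> w _; rewrite /= ger0_norm// dot_ge0.
  by rewrite -[LHS]fineK ?integrable_fin_num// -/(Rintegral _ _ _) D0.
move=> /(ae_eq_integral_abs P measurableT mD).1.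
by apply: filterS => w /(_ I) /= [] /dot_eq0.
Qed.

Section Variation.
Context {R : realType} {d : measure_display} {T : measurableType d}
  (P : probability T R) (om : nat -> T -> R) (N n m : nat)
  (A C : nat -> 'M[R]_n) (B : nat -> 'M[R]_(n, m)) (q : nat -> T -> 'cV[R]_n)
  (G0 : 'M[R]_n) (Q : nat -> 'M[R]_n) (Rm : nat -> 'M[R]_m)
  (S : nat -> 'M[R]_(m, n)) (eta : nat -> T -> 'cV[R]_n)
  (rho : nat -> T -> 'cV[R]_m) (xi : T -> 'cV[R]_n).
Hypotheses (Pc : measure_is_complete P)
  (mom : forall k, measurable_fun setT (om k))
  (uv : forall k, (k < N)%N -> unit_variance P (Fm P om k) (om k)).
Hypotheses (G0T : G0^T = G0)
  (QT : forall k, (k < N)%N -> (Q k)^T = Q k)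
  (RT : forall k, (k < N)%N -> (Rm k)^T = Rm k)
  (heta : forall k, (k < N)%N -> L2G P (Fm P om k) (eta k))
  (hrho : forall k, (k < N)%N -> L2G P (Fm P om k) (rho k)).

Implicit Types (x y z ybar zbar : nat -> T -> 'cV[R]_n) (u v : nat -> T -> 'cV[R]_m).

Let hetarho k : (k < N)%N -> L2v P (eta k) /\ L2v P (rho k).
Proof. by move=> kN; split; [exact: (heta kN).2|exact: (hrho kN).2]. Qed.

Local Notation state := (is_state P om N A C B).
Local Notation cost := (cost_integrand N G0 Q Rm S eta rho).
Let sF k : sigma_algebra setT (Fm P om k) := sigma_algebra_Fm P om k.

(** Serves both directions: necessity with [a] arbitrary and [v] opposite to the stationarity
    residual, sufficiency with [a = 1] and [v] the difference of two controls. *)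
Lemma cost_variation u y ybar x v z zbar (a : R) :
  admissible P om N u -> admissible P om N v ->
  state q xi u y ybar -> state (fun _ _ => 0) (fun=> 0) v z zbar ->
  {ae P, forall w, x 0 w = G0 *m y 0 w} ->
  adjoint P om N A C Q S eta u x ybar ->
  \int[P]_w cost (fun k w => u k w + a *: v k w)
    (fun k w => y k w + a *: z k w) (fun k w => ybar k w + a *: zbar k w) w =
  \int[P]_w cost u y ybar w +
  2 * a * \sum_(k < N) \int[P]_w dot (stationarity B Rm S rho u x ybar k w) (v k w) +
  a ^+ 2 * \int[P]_w quad_cost N G0 Q Rm S v z zbar w.
Proof.
move=> au av hs hz x0 hx.
have hy0 := (hs.1 0%N isT).2; have hz0 := (hz.1 0%N isT).2.
have hyb k (kN : (k < N)%N) := state_ybar Pc mom hs kN.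
have hzb k (kN : (k < N)%N) := state_ybar Pc mom hz kN.
have ic : intg P (cost u y ybar).
  by apply: intg_cost => // k kN; split; [exact: (au k kN).2|exact: (hyb k kN).2].
have iq : intg P (quad_cost N G0 Q Rm S v z zbar).
  apply: intg_cost => // k kN; first by split; exact: L2v0.
  by split; [exact: (av k kN).2|exact: (hzb k kN).2].
have iv : intg P (first_variation N G0 Q Rm S eta rho u y ybar v z zbar).
  apply: intg_first_variation => // k kN; split.
  - exact: (au k kN).2.
  - exact: (hyb k kN).2.
  - exact: (av k kN).2.
  - exact: (hzb k kN).2.
rewrite -(first_variationE Rm Pc mom uv hetarho (G0 := G0) (Q := Q) (y := y)
  _ x0 hy0 hx hz); last first.
  move=> k kN; split; [exact: au|exact: hyb|exact: heta|exact: (av k kN).2].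
under eq_Rintegral do rewrite cost_expansion//.
rewrite RintegralD//; [|by apply: intgD => //; exact: intgZ|exact: intgZ].
rewrite RintegralD//; [|exact: intgZ].
by rewrite !RintegralZl.
Qed.

(** Makes the stationarity residual usable as an admissible control direction. *)
Lemma stationarity_L2G u y ybar x k : admissible P om N u ->
  state q xi u y ybar -> adjoint P om N A C Q S eta u x ybar -> (k < N)%N ->
  L2G P (Fm P om k) (stationarity B Rm S rho u x ybar k).
Proof.
move=> au hs hx kN; apply: (L2GD (sF k)); last exact: hrho.
apply: (L2GD (sF k)); last by apply: (L2G_mulmx (sF k)); exact: au.
apply: (L2GD (sF k)); apply: (L2G_mulmx (sF k)).
  by apply: hx.1; exact: ltnW.
exact: (state_ybar Pc mom hs kN).
Qed.

Lemma quad_cost_ge0 (delta : R) v z zbar (w : T) :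
  (forall v : 'cV[R]_n, 0 <= dot v (G0 *m v)) -> 0 < delta ->
  (forall k, (k < N)%N -> forall v : 'cV[R]_m,
     delta * dot v v <= dot v (Rm k *m v)) ->
  (forall k, (k < N)%N -> forall v : 'cV[R]_n,
     0 <= dot v ((Q k - (S k)^T *m invmx (Rm k) *m S k) *m v)) ->
  0 <= quad_cost N G0 Q Rm S v z zbar w.
Proof.
move=> G0P d0 RP QP; rewrite /quad_cost /cost_integrand dot_quad.
apply: addr_ge0 => //; apply: sumr_ge0 => k _; have kN := ltn_ord k.
rewrite !dot_quad -!/(dot _ _) ![dot 0 _]dotC !dot0r mulr0 !addr0.
exact: schur_ge0 d0 (RT kN) (RP k kN) (QP k kN _).
Qed.

(** With control and state fixed, the forward equation is decoupled from the backward one and can be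
    solved by explicit recursion. *)
Fixpoint adjoint_process (u : nat -> T -> 'cV[R]_m) (ybar : nat -> T -> 'cV[R]_n)
    (x0 : T -> 'cV[R]_n) (k : nat) (w : T) : 'cV[R]_n :=
  if k is j.+1 then
    (A j)^T *m adjoint_process u ybar x0 j w + adjoint_source Q S eta u ybar j w
    + om j w *: ((C j)^T *m adjoint_process u ybar x0 j w)
  else x0 w.

(** The noise term raises the measurability index by one, and the isometry keeps it
    square-integrable. *)
Lemma adjoint_processP u ybar (x0 : T -> 'cV[R]_n) : admissible P om N u ->
  (forall k, (k < N)%N -> L2G P (Fm P om k) (ybar k)) ->
  L2G P (Fm P om 0) x0 ->
  adjoint P om N A C Q S eta u (adjoint_process u ybar x0) ybar.
Proof.
move=> au hyb hx0; split; last by move=> k kN; exact: aeW.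
elim=> [//|k IH kN]; have hx := IH (ltnW kN).
have hsrc : L2G P (Fm P om k) (adjoint_source Q S eta u ybar k).
  apply: (L2GD (sF k)); last exact: heta.
  by apply: (L2GD (sF k)); apply: (L2G_mulmx (sF k)); [exact: hyb|exact: au].
have hCx := L2G_mulmx (sF k) (C k)^T hx.
apply: (L2GD (sF k.+1)).
  apply: L2GS (@FmS _ _ _ P om k) _.
  by apply: (L2GD (sF k)) => //; exact: (L2G_mulmx (sF k)).
split; last exact: (L2v_noise (sF k) (Fm_measurable Pc mom (k:=k)) (uv kN) hCx).
move=> i; under eq_fun do rewrite mxE.
apply: (rmeasM (sF k.+1)); first exact: rmeas_om.
exact: (L2GS (@FmS _ _ _ P om k) hCx).1.
Qed.

End Variation.

Theorem theorem4p1 (R : realType) (d : measure_display) (Omega : measurableType d)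
  (P : probability Omega R) (om : nat -> Omega -> R) (N n m : nat)
  (A C : nat -> 'M[R]_n) (B : nat -> 'M[R]_(n, m)) (q : nat -> Omega -> 'cV[R]_n)
  (G0 : 'M[R]_n) (Q : nat -> 'M[R]_n) (Rm : nat -> 'M[R]_m)
  (S : nat -> 'M[R]_(m, n)) (eta : nat -> Omega -> 'cV[R]_n)
  (rho : nat -> Omega -> 'cV[R]_m)
  (xi : Omega -> 'cV[R]_n) (us : nat -> Omega -> 'cV[R]_m) :
  (* standing setting *)
  (0 < N)%N -> (0 < n)%N -> (0 < m)%N ->
  measure_is_complete P ->
  (forall k, measurable_fun setT (om k)) ->
  (forall k, (k < N)%N ->
     P.-integrable setT (fun w => ((om k w) ^+ 2)%:E) /\
     (forall E, Fm P om k E ->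
        (\int[P]_(w in E) (om k w)%:E = 0)%E /\
        (\int[P]_(w in E) ((om k w) ^+ 2)%:E = P E)%E)) ->
  (* (A1) *)
  (forall k, (k < N)%N -> vmeas (Fm P om k) (q k) /\ L2v P (q k)) ->
  (* (A2) *)
  G0^T = G0 ->
  (forall k, (k < N)%N -> (Q k)^T = Q k /\ (Rm k)^T = Rm k) ->
  (forall k, (k < N)%N -> vmeas (Fm P om k) (eta k) /\ L2v P (eta k) /\
                          vmeas (Fm P om k) (rho k) /\ L2v P (rho k)) ->
  (* (A3) *)
  (forall v : 'cV[R]_n, 0 <= (v^T *m G0 *m v) 0 0) ->
  (exists2 delta : R, 0 < delta & forall k, (k < N)%N ->
     forall v : 'cV[R]_m, delta * (v^T *m v) 0 0 <= (v^T *m Rm k *m v) 0 0) ->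
  (forall k, (k < N)%N -> forall v : 'cV[R]_n,
     0 <= (v^T *m (Q k - (S k)^T *m invmx (Rm k) *m S k) *m v) 0 0) ->
  (* terminal state in L^2_{F_{N-1}} *)
  vmeas (Fm P om N) xi -> L2v P xi ->
  (* control in U *)
  admissible P om N us ->
  (optimal P om N A C B q G0 Q Rm S eta rho xi us <->
   exists x y : nat -> Omega -> 'cV[R]_n,
     hamiltonian P om N A C B q G0 Q Rm S eta rho xi us x y).
Proof.
move=> _ _ _ Pc mom hom hq G0T QRT her G0P [delta d0 RP] QP _ _ aus.
have uv k : (k < N)%N -> unit_variance P (Fm P om k) (om k).
  by move=> kN; have [i2 hE] := hom k kN; split; [split => //; exact: mom|move=> E /hE[]].
have QT k (kN : (k < N)%N) := (QRT k kN).1.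
have RT k (kN : (k < N)%N) := (QRT k kN).2.
have heta k : (k < N)%N -> L2G P (Fm P om k) (eta k).
  by move=> /her[h1 [h2 _]]; split.
have hrho k : (k < N)%N -> L2G P (Fm P om k) (rho k).
  by move=> /her[_ [_ [h1 h2]]]; split.
have hetarho k (kN : (k < N)%N) := conj (heta k kN).2 (hrho k kN).2.
have sF k : sigma_algebra setT (Fm P om k) := sigma_algebra_Fm P om k.
have cE := cost_isE A C B G0 Q Rm S Pc mom hetarho q xi.
split.
- move=> [_ [cs [/(cE _ _ aus)[y [yb [hs csE]]] opt]]].
  have hyb k (kN : (k < N)%N) := state_ybar Pc mom hs kN.
  have hy0 := hs.1 0%N isT.
  pose x := adjoint_process om A C Q S eta us yb (fun w => G0 *m y 0 w).
  have hx : adjoint P om N A C Q S eta us x yb.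
    by apply: adjoint_processP => //; exact: (L2G_mulmx (sF 0%N)).
  pose D := stationarity B Rm S rho us x yb.
  have hD k (kN : (k < N)%N) : L2G P (Fm P om k) (D k).
    exact: (stationarity_L2G Rm Pc mom hrho aus hs hx kN).
  pose v k w := (-1) *: D k w.
  have av : admissible P om N v by move=> k kN; apply: (L2GZ (sF k)); exact: hD.
  have [z [zb hz]] := state_exists A C B Pc mom uv av.
  have DD : \sum_(k < N) \int[P]_w dot (D k w) (v k w) = 0.
    (* The factor 1/2 of the cost cancels the 2 in the linear term [2 * a] and halves the quadratic
       coefficient, whence the [2^-1] here. *)
    apply: (@linear_coef_eq0 _ _ (2^-1 * \int[P]_w quad_cost N G0 Q Rm S v z zb w)) => a.
    have au : admissible P om N (fun k w => us k w + a *: v k w).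
      move=> k kN; apply: (L2GD (sF k)); first exact: aus.
      by apply: (L2GZ (sF k)); exact: av.
    have cv := cost_variation Pc mom uv G0T QT RT heta hrho a aus av hs hz
      (aeW _ (fun w => erefl)) hx.
    have := opt _ _ au ((cE _ _ au).2 (ex_intro _ _ (ex_intro _ _
      (conj (state_perturb Pc mom a hs hz) erefl)))).
    by rewrite cv csE -/D; lra.
  have D0 k : (k < N)%N -> {ae P, forall w, D k w = 0}.
    move=> kN; apply: (Rintegral_dot_eq0 (hD k kN).2).
    (* As [v = - D], the vanishing linear coefficient is minus a sum of nonnegative second moments,
       so each of them is zero. *)
    have vE (j : 'I_N) : \int[P]_w dot (D j w) (D j w) = - \int[P]_w dot (D j w) (v j w).
      have hj := (hD j (ltn_ord j)).2.
      under [in RHS]eq_Rintegral do rewrite dotZr.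
      by rewrite RintegralZl ?mulN1r ?opprK//; exact: intg_dot.
    have := DD; rewrite -[LHS]opprK -sumrN => /eqP; rewrite oppr_eq0.
    rewrite -(eq_bigr _ (fun j _ => vE j)) => /eqP.
    move=> /psumr_eq0P/(_ (Ordinal kN) isT); apply => j _.
    by apply: Rintegral_ge0 => w _; exact: dot_ge0.
  exists x, y; split; [|split; [|split]].
  + by move=> k kN; have [h1 h2] := hx.1 k kN; have [h3 h4] := hs.1 k kN.
  + exact: aeW.
  + exact: hs.2.1.
  + move=> k kN; have [_ [_ /(_ k kN)[cb [yw [cw ey]]]]] := hs.
    exists (yb k), yw; do 2 split => //; split.
      by apply: filterS (hx.2 k kN) => w ->; rewrite /adjoint_source !addrA.
    by split => //; exact: D0.
- move=> [x [y [hxy [x0 [yN hk]]]]].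
  (* [hamiltonian] supplies [ybar] separately at each time; choice assembles these into a process,
     with 0 from time [N] on. *)
  have /choice[yb hyb] : forall k, exists yb, (k < N)%N -> exists yw,
      cexpv P (Fm P om k) (y k.+1) yb /\
      cexpv P (Fm P om k) (fun w => om k w *: y k.+1 w) yw /\
      {ae P, forall w, x k.+1 w =
         (A k)^T *m x k w + Q k *m yb w + (S k)^T *m us k w + eta k w
         + om k w *: ((C k)^T *m x k w)} /\
      {ae P, forall w, y k w =
         A k *m yb w + B k *m us k w + C k *m yw w + q k w} /\
      {ae P, forall w,
         (B k)^T *m x k w + S k *m yb w + Rm k *m us k w + rho k w = 0}.
    move=> k; have [kN|_] := ltnP k N; last by exists (fun=> 0).
    by have [yb hyb] := hk k kN; exists yb.
  have hs : is_state P om N A C B q xi us y yb.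
    split; [|split => //].
      by move=> k kN; have [_ [_ [h1 h2]]] := hxy k kN.
    move=> k kN; have [yw [h1 [h2 [_ [h3 _]]]]] := hyb k kN.
    by split => //; exists yw.
  have hx : adjoint P om N A C Q S eta us x yb.
    split=> k kN; first by have [h1 [h2 _]] := hxy k kN.
    have [yw [_ [_ [h _]]]] := hyb k kN.
    by apply: filterS h => w ->; rewrite /adjoint_source !addrA.
  split => //; eexists; split; first by apply/(cE _ _ aus); exists y, yb; split.
  move=> u c au /(cE _ _ au)[y' [yb' [hs' ->]]].
  pose v k w := u k w + (-1) *: us k w.
  have av : admissible P om N v.
    move=> k kN; apply: (L2GD (sF k)); first exact: au.
    by apply: (L2GZ (sF k)); exact: aus.
  have hz := state_sub Pc mom hs' hs.
  have hD k (kN : (k < N)%N) : L2G P (Fm P om k) (stationarity B Rm S rho us x yb k).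
    by exact: (stationarity_L2G Rm Pc mom hrho aus hs hx kN).
  have := cost_variation Pc mom uv G0T QT RT heta hrho 1 aus av hs hz x0 hx.
  (* Perturbing by the full difference with [a = 1] recovers the competitor, so the variation
     formula compares the two costs exactly. *)
  have back p (f f' : nat -> Omega -> 'cV[R]_p) :
      (fun k w => f k w + 1 *: (f' k w + (-1) *: f k w)) = f'.
    apply/funext => k; apply/funext => w.
    by rewrite scale1r scaleN1r addrC subrK.
  rewrite !back => ->.
  rewrite big1 ?mulr0 ?addr0 => [|k _]; last first.
    have [yw [_ [_ [_ [_ h]]]]] := hyb k (ltn_ord k).
    rewrite (@eq_Rintegral_ae _ _ _ P _ (fun=> 0)).
    - by rewrite /Rintegral integral0.
    - by apply: intg_dot; [exact: (hD k _).2|exact: (av k _).2].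
    - exact: integrable0.
    - by apply: filterS h => w Dw; rewrite /stationarity Dw dotC dot0r.
  rewrite ler_wpM2l ?invr_ge0// lerDl expr1n mul1r.
  apply: Rintegral_ge0 => w _.
  apply: (@quad_cost_ge0 _ _ _ N n m G0 Q Rm S RT delta) => //.
  + by move=> s; rewrite -dot_quad.
  + by move=> k kN s; rewrite -[X in _ <= X]dot_quad; exact: RP.
  + by move=> k kN s; rewrite -[X in _ <= X]dot_quad; exact: QP.
Qed.
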